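(* Let $\rho=(12)(45)(78)$ and $\mu_{4,0}(n)=4n \bmod 9$ (so $\mu_{4,0}=(147)(285)$), as permutations of $\{0,\dots,8\}$. Then $H_{mm}\times\langle\rho,\mu_{4,0}\rangle$ is a minimal complete modular-magic Sudoku symmetry group: its orbits on the set of modular-magic Sudoku boards coincide with the orbits of $G_{mm}$ (so there are exactly two of them), and no subgroup of $G_{mm}$ of smaller order has orbits coinciding with those of $G_{mm}$.
   Context: A Sudoku board is a $9\times 9$ array with entries from $\{0,\dots,8\}$ such that every row, every column, and every one of the nine $3\times 3$ blocks contains each symbol exactly once. A modular-magic Sudoku board is a Sudoku board in which, for every block, the entries of each of its three rows, three columns and two diagonals sum to a multiple of $9$. The physical Sudoku symmetry group $H_9$ is the group of rearrangements of the $81$ cells generated by permutations of the three bands (horizontal strips of blocks), permutations of the rows within a band, permutations of the three pillars (vertical strips of blocks), permutations of the columns within a pillar, and the transpose. $H_{mm}$ is the subgroup of $H_9$ of elements mapping every modular-magic board to a modular-magic board (order $4608$). A relabeling is a permutation of the symbols $\{0,\dots,8\}$ applied to every entry. $S_{mm}$ is the group of relabelings generated by $\rho=(12)(45)(78)$ and the maps $\mu_{k,l}(n)=kn+l \bmod 9$ for $k\in\{1,2,4,5,7,8\}$, $l\in\{0,3,6\}$ (it has order $36$ and consists of the relabelings preserving modular-magic boards). $G_{mm}=H_{mm}\times S_{mm}$ acts on the set of modular-magic boards; it is known to have exactly two orbits. *)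

(* Defs.v *)
From HB Require Import structures.
From mathcomp Require Import all_boot all_order all_fingroup.
Set Implicit Arguments. Unset Strict Implicit. Unset Printing Implicit Defensive.


(* Cells of the 9x9 grid: (row, column); symbols are 'I_9 = {0,...,8}. *)
Definition cell := ('I_9 * 'I_9)%type.
Definition board := {ffun cell -> 'I_9}.

(* A permutation built from a function; the function is used whenever it is
   injective (which is the case for every use below), else the identity. *)
Definition mkperm (T : finType) (f : T -> T) : {perm T} :=
  match @injectiveP T T f with
  | ReflectT inj => perm inj
  | ReflectF _ => 1%g
  end.

Definition in_block (i j : 'I_3) (x : cell) : bool :=
  (x.1 %/ 3 == i) && (x.2 %/ 3 == j).

Definition sudoku (b : board) : bool :=
  [&& [forall r : 'I_9, forall s : 'I_9, #|[set c : 'I_9 | b (r, c) == s]| == 1],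
      [forall c : 'I_9, forall s : 'I_9, #|[set r : 'I_9 | b (r, c) == s]| == 1] &
      [forall i : 'I_3, forall j : 'I_3, forall s : 'I_9,
         #|[set x : cell | in_block i j x && (b x == s)]| == 1]].

Definition bcell (i j u v : 'I_3) : cell :=
  (inord (3 * i + u), inord (3 * j + v)).

Definition modmagic_blocks (b : board) : bool :=
  [forall i : 'I_3, forall j : 'I_3,
    [&& [forall u : 'I_3, (\sum_(v < 3) val (b (bcell i j u v))) %% 9 == 0],
        [forall v : 'I_3, (\sum_(u < 3) val (b (bcell i j u v))) %% 9 == 0],
        (\sum_(u < 3) val (b (bcell i j u u))) %% 9 == 0 &
        (\sum_(u < 3) val (b (bcell i j u (rev_ord u)))) %% 9 == 0]].

Definition modmagic (b : board) : bool := sudoku b && modmagic_blocks b.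

Definition band_perm (s : {perm 'I_3}) : {perm 'I_9} :=
  mkperm (fun r : 'I_9 => inord (3 * s (inord (r %/ 3) : 'I_3) + r %% 3)).
Definition inband_perm (k : 'I_3) (t : {perm 'I_3}) : {perm 'I_9} :=
  mkperm (fun r : 'I_9 =>
    if r %/ 3 == k then inord (3 * k + t (inord (r %% 3) : 'I_3)) else r).

Definition line_gens : {set {perm 'I_9}} :=
  [set band_perm s | s : {perm 'I_3}] :|:
  [set inband_perm k t | k : 'I_3, t : {perm 'I_3}].

Definition rowp (p : {perm 'I_9}) : {perm cell} := mkperm (fun x : cell => (p x.1, x.2)).
Definition colp (p : {perm 'I_9}) : {perm cell} := mkperm (fun x : cell => (x.1, p x.2)).
Definition transp : {perm cell} := mkperm (fun x : cell => (x.2, x.1)).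

Definition H9 : {set {perm cell}} :=
  (<<[set rowp p | p in line_gens] :|: [set colp p | p in line_gens] :|: [set transp]>>)%g.

(* a cell rearrangement h moves the entry of cell x to cell h x *)
Definition actH (h : {perm cell}) (b : board) : board := [ffun x => b ((h^-1)%g x)].
Definition actG (g : {perm cell} * {perm 'I_9}) (b : board) : board :=
  [ffun x => g.2 (b ((g.1^-1)%g x))].

Definition Hmm : {set {perm cell}} :=
  [set h in H9 | [forall b : board, modmagic b ==> modmagic (actH h b)]].

Definition rho_fun (n : 'I_9) : 'I_9 :=
  match val n with
  | 1 => inord 2 | 2 => inord 1 | 4 => inord 5 | 5 => inord 4
  | 7 => inord 8 | 8 => inord 7 | _ => n end.
Definition rho : {perm 'I_9} := mkperm rho_fun.
Definition mu (k l : nat) : {perm 'I_9} :=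
  mkperm (fun n : 'I_9 => inord ((k * n + l) %% 9)).

Definition mu_gens : {set {perm 'I_9}} :=
  [set mu (val k) (val l) | k : 'I_9 in [set k : 'I_9 | val k \in [:: 1; 2; 4; 5; 7; 8]],
                l : 'I_9 in [set l : 'I_9 | val l \in [:: 0; 3; 6]]].

Definition Smm : {set {perm 'I_9}} := (<<rho |: mu_gens>>)%g.

Definition Gmm : {set {perm cell} * {perm 'I_9}} := setX Hmm Smm.

Definition orb (A : {set {perm cell} * {perm 'I_9}}) (b : board) : {set board} :=
  [set actG g b | g in A].

(* Main.v *)
Require Import Defs.
From HB Require Import structures.
From mathcomp Require Import all_boot all_order all_fingroup.
From mathcomp Require Import cyclic zify.

(** Reflecting the outer rows of a band (or the outer columns of a pillar),
    permuting bands and pillars, and transposing all preserve modular-magic boards,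
    so that Hmm has at least 2 * (3! * 2^3)^2 = 4608 elements.  Conversely an element
    of Hmm sends block centres to block centres, which makes it one of these moves.

    The 72 modular-magic blocks are found by search, and so are all ways to fill a
    board with them; this bounds the number of modular-magic boards by
    72 * 448 = 32256 = 27648 + 4608.  Running through the moves and relabelings shows
    that K = Hmm x <rho, mu_{4,0}>, of order at least 27648, acts freely on [board1],
    that the stabiliser of [board2] in K has at most 6 elements, and that no element of
    Gmm sends [board1] to [board2].  Hence the K-orbits of these two boards exhaust the
    modular-magic boards and coincide with the Gmm-orbits, and a group with the same
    orbits has at least as many elements as the orbit of [board1], namely |K|. *)

Set Implicit Arguments. Unset Strict Implicit. Unset Printing Implicit Defensive.

Local Open Scope group_scope.

(** * Coordinates of a line within its band, and pointwise formulas for the generators *)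

Lemma mkpermE (T : finType) (f : T -> T) : injective f -> mkperm f =1 f.
Proof. by move=> inj_f x; rewrite /mkperm; case: injectiveP => // i; rewrite permE. Qed.

Definition ix (i u : 'I_3) : 'I_9 := inord (3 * i + u).
Definition hd (r : 'I_9) : 'I_3 := inord (r %/ 3).
Definition tl (r : 'I_9) : 'I_3 := inord (r %% 3).

Lemma val_ix i u : ix i u = (3 * i + u)%N :> nat.
Proof. by rewrite inordK //; have := ltn_ord i; have := ltn_ord u; lia. Qed.

Lemma val_hd r : hd r = (r %/ 3)%N :> nat.
Proof. by rewrite inordK //; have := ltn_ord r; lia. Qed.

Lemma val_tl r : tl r = (r %% 3)%N :> nat.
Proof. by rewrite inordK // ltn_mod. Qed.

Lemma hd_ix i u : hd (ix i u) = i.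
Proof. by apply: val_inj; rewrite /= val_hd val_ix; have := ltn_ord u; lia. Qed.

Lemma tl_ix i u : tl (ix i u) = u.
Proof. by apply: val_inj; rewrite /= val_tl val_ix; have := ltn_ord u; lia. Qed.

Lemma ixK r : ix (hd r) (tl r) = r.
Proof. by apply: val_inj; rewrite /= val_ix val_hd val_tl; lia. Qed.

Lemma ix_inj i u j v : ix i u = ix j v -> i = j /\ u = v.
Proof. by move=> e; split; [rewrite -(hd_ix i u) e hd_ix | rewrite -(tl_ix i u) e tl_ix]. Qed.

Lemma eq_hd r r' : (hd r == hd r') = (r %/ 3 == r' %/ 3).
Proof. by rewrite -val_eqE /= !val_hd. Qed.

Lemma band_permE s r : band_perm s r = ix (s (hd r)) (tl r).
Proof.
have e (x : 'I_9) : inord (3 * s (inord (x %/ 3) : 'I_3) + x %% 3) = ix (s (hd x)) (tl x).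
  by rewrite /ix val_tl.
rewrite mkpermE // => x y; rewrite !e => /ix_inj[/perm_inj ehd etl].
by rewrite -(ixK x) ehd etl ixK.
Qed.

Lemma inband_permE k t r :
  inband_perm k t r = if hd r == k then ix k (t (tl r)) else r.
Proof.
have e (x : 'I_9) : (if x %/ 3 == k then inord (3 * k + t (inord (x %% 3) : 'I_3)) else x) =
    if hd x == k then ix k (t (tl x)) else x.
  by rewrite -val_eqE /= val_hd.
rewrite /inband_perm mkpermE => [|x y]; rewrite !e //.
case: eqP => [xk|xk]; case: eqP => [yk|yk] //.
- move=> /ix_inj[_ /perm_inj etl].
  by rewrite -(ixK x) xk etl -yk ixK.
- by move=> e'; case: yk; rewrite -e' hd_ix.
- by move=> e'; case: xk; rewrite e' hd_ix.
Qed.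

Lemma rowpE p x : rowp p x = (p x.1, x.2).
Proof. by rewrite mkpermE // => -[? ?] [? ?] /= [/perm_inj-> ->]. Qed.

Lemma colpE p x : colp p x = (x.1, p x.2).
Proof. by rewrite mkpermE // => -[? ?] [? ?] /= [-> /perm_inj->]. Qed.

Lemma transpE x : transp x = (x.2, x.1).
Proof. by rewrite mkpermE // => -[? ?] [? ?] /= [-> ->]. Qed.

(** * Propositional forms of the Sudoku and modular-magic conditions *)

Definition sud (b : board) : Prop :=
  [/\ forall r, injective (fun c => b (r, c)),
      forall c, injective (fun r => b (r, c)) &
      forall x y, hd x.1 = hd y.1 -> hd x.2 = hd y.2 -> b x = b y -> x = y].

Lemma in_blockE i j (x : cell) : in_block i j x = (hd x.1 == i) && (hd x.2 == j).
Proof. by rewrite /in_block -!val_eqE /= !val_hd. Qed.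

(** By counting, nine cells with pairwise distinct entries use all nine symbols, so every fibre is a
    single point. This is what turns the exactly-once conditions into injectivity in [sud]. *)
Lemma card_fiber1 (T : finType) (A : pred T) (f : T -> 'I_9) :
  #|A| = 9 -> {in A &, injective f} -> forall s, #|[set x | A x && (f x == s)]| == 1%N.
Proof.
move=> cA injf s.
have fA : f @: A = setT.
  by apply/eqP; rewrite eqEcard subsetT cardsT card_ord card_in_imset // cA.
have /imsetP[x Ax ->] : s \in f @: A by rewrite fA inE.
apply/cards1P; exists x; apply/setP => y; rewrite !inE.
apply/andP/eqP => [[Ay /eqP]|->]; last by rewrite eqxx.
exact: injf.
Qed.

Lemma card_in_block i j : #|in_block i j| = 9.
Proof.
have -> : #|in_block i j| = #|[set bcell i j u.1 u.2 | u : 'I_3 * 'I_3]|.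
  apply: eq_card => x; rewrite [x \in in_block i j]in_blockE.
  apply/andP/imsetP => [[/eqP<- /eqP<-]|[[u v] _ ->] /=]; last by rewrite !hd_ix !eqxx.
  by exists (tl x.1, tl x.2) => //=; rewrite /bcell -!/(ix _ _) !ixK; case: x.
rewrite card_imset ?card_prod ?card_ord // => -[u v] [u' v'] [].
by move=> /ix_inj[_ /= ->] /ix_inj[_ /= ->].
Qed.

Lemma sudP b : reflect (sud b) (sudoku b).
Proof.
have c1 (T : finType) (A : {set T}) x y : #|A| == 1%N -> x \in A -> y \in A -> x = y.
  by move=> /cards1P[z ->] /set1P-> /set1P->.
apply: (iffP and3P) => [[/forallP hr /forallP hc /forallP hb]|[hr hc hb]]; split.
- move=> r c c' e; have /forallP/(_ (b (r, c))) := hr r.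
  by move/c1; apply; rewrite inE // e.
- move=> c r r' e; have /forallP/(_ (b (r, c))) := hc c.
  by move/c1; apply; rewrite inE // e.
- move=> x y e1 e2 e; have /forallP/(_ (hd x.2))/forallP/(_ (b x)) := hb (hd x.1).
  by move/c1; apply; rewrite inE in_blockE ?e1 ?e2 ?e !eqxx.
- apply/forallP => r; apply/forallP => s.
  have := @card_fiber1 _ predT (fun c => b (r, c)) (card_ord 9) (in2W (hr r)) s.
  by congr (_ == _); apply: eq_card => c; rewrite !inE.
- apply/forallP => r; apply/forallP => s.
  have := @card_fiber1 _ predT (fun c => b (c, r)) (card_ord 9) (in2W (hc r)) s.
  by congr (_ == _); apply: eq_card => c; rewrite !inE.
- apply/forallP => i; apply/forallP => j; apply/forallP.
  apply: card_fiber1; first exact: card_in_block.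
  move=> x y; rewrite ![_ \in _]in_blockE => /andP[/eqP xi /eqP xj] /andP[/eqP yi /eqP yj].
  by apply: hb; rewrite ?xi ?xj ?yi ?yj.
Qed.

Definition magic_block (b : board) (i j : 'I_3) : Prop :=
  [/\ forall u, 9 %| \sum_(v < 3) b (ix i u, ix j v),
      forall v, 9 %| \sum_(u < 3) b (ix i u, ix j v),
      9 %| \sum_(u < 3) b (ix i u, ix j u) &
      9 %| \sum_(u < 3) b (ix i u, ix j (rev_ord u))].

Lemma magicP b : reflect (forall i j, magic_block b i j) (modmagic_blocks b).
Proof.
apply: (iffP forallP) => h i.
  by move=> j; have /forallP/(_ j)/and4P[/forallP ? /forallP ? ? ?] := h i.
by apply/forallP => j; have [hr hc hd ha] := h i j; apply/and4P; split=> //; apply/forallP.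
Qed.

Lemma modmagicP b : reflect (sud b /\ forall i j, magic_block b i j) (modmagic b).
Proof. by apply: (iffP andP) => -[/sudP ? /magicP ?]. Qed.

(** * The group of cell rearrangements that preserve modular-magic boards *)

Definition pull (h : {perm cell}) (b : board) : board := [ffun x => b (h x)].

Lemma pullM g h b : pull (g * h) b = pull g (pull h b).
Proof. by apply/ffunP => x; rewrite !ffunE permM. Qed.

Definition magic_moves : {set {perm cell}} :=
  [set h | [forall b : board, modmagic b ==> modmagic (pull h b)]].

Lemma magic_movesP h :
  reflect (forall b, modmagic b -> modmagic (pull h b)) (h \in magic_moves).
Proof. by rewrite inE; apply: (iffP forallP) => hh b; apply/implyP/hh. Qed.

Lemma magic_moves_group_set : group_set magic_moves.
Proof.
apply/group_setP; split=> [|g h /magic_movesP hg /magic_movesP hh].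
  apply/magic_movesP => b; suff -> : pull 1 b = b by [].
  by apply/ffunP => x; rewrite ffunE perm1.
by apply/magic_movesP => b mb; rewrite pullM; apply/hg/hh.
Qed.
Canonical magic_moves_group := Group magic_moves_group_set.

(** [actH h] is [pull] along the inverse of [h], and a set of permutations of a finite set closed
    under products is closed under inverses, so both conventions give the same subgroup. *)
Lemma HmmE : Hmm = H9 :&: magic_moves.
Proof. apply/setP => h; rewrite in_set in_setI; congr (_ && _).
by rewrite -(groupV magic_moves_group) in_set. Qed.

Lemma Hmm_group_set : group_set Hmm.
Proof. by rewrite HmmE; apply: groupP. Qed.
Canonical Hmm_group := Group Hmm_group_set.

(** * Normal form of the physical symmetries: an optional transpose, then a row and a column
    permutation *)

Definition banded : {set {perm 'I_9}} :=
  [set p : {perm 'I_9} | [forall r, forall r', (hd r == hd r') ==> (hd (p r) == hd (p r'))]].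

Lemma bandedP (p : {perm 'I_9}) :
  reflect (forall r r', hd r = hd r' -> hd (p r) = hd (p r')) (p \in banded).
Proof.
rewrite inE; apply: (iffP forallP) => h r => [r' /eqP e|].
  by apply/eqP; have /forallP/(_ r')/implyP := h r; apply.
by apply/forallP => r'; apply/implyP => /eqP/h->.
Qed.

Lemma banded_group_set : group_set banded.
Proof.
apply/group_setP; split=> [|p q /bandedP hp /bandedP hq]; apply/bandedP => r r' e.
  by rewrite !perm1.
by rewrite !permM; apply/hq/hp.
Qed.
Canonical banded_group := Group banded_group_set.

Lemma line_gens_banded : line_gens \subset banded.
Proof.
apply/subsetP => _ /setUP[/imsetP[s _ ->]|/imset2P[k t _ _ ->]]; apply/bandedP => r r' e.
  by rewrite !band_permE !hd_ix e.
by rewrite !inband_permE e; case: eqP => // _; rewrite !hd_ix.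
Qed.

Definition move (t : bool) (p q : {perm 'I_9}) : {perm cell} :=
  (if t then transp else 1) * rowp p * colp q.

Lemma moveE t p q x : move t p q x = if t then (p x.2, q x.1) else (p x.1, q x.2).
Proof.
by rewrite /move !permM colpE rowpE; case: t; rewrite ?transpE ?perm1.
Qed.

(** Products are read from left to right. A transpose in the second factor exchanges the
    coordinates, so the row part of the first factor continues with the column part of the
    second. *)
Lemma moveM t p q t' p' q' :
  move t p q * move t' p' q' =
  move (t (+) t') (if t' then q * p' else p * p') (if t' then p * q' else q * q').
Proof. by apply/permP => x; rewrite permM !moveE; case: t t' => [] []; rewrite !permM. Qed.

Definition banded_moves : {set {perm cell}} :=
  [set h : {perm cell} | [exists t, exists p in banded, exists q in banded, h == move t p q]].

Lemma banded_movesP h :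
  reflect (exists t p q, [/\ p \in banded, q \in banded & h = move t p q])
          (h \in banded_moves).
Proof.
rewrite inE; apply: (iffP existsP) => -[t].
  by case/existsP=> p /andP[hp /existsP[q /andP[hq /eqP e]]]; exists t, p, q.
case=> p [q [hp hq ->]]; exists t; apply/existsP; exists p; rewrite hp /=.
by apply/existsP; exists q; rewrite hq eqxx.
Qed.

Lemma rowp_move p : rowp p = move false p 1.
Proof. by apply/permP => x; rewrite moveE rowpE perm1. Qed.

Lemma colp_move p : colp p = move false 1 p.
Proof. by apply/permP => x; rewrite moveE colpE perm1. Qed.

Lemma transp_move : transp = move true 1 1.
Proof. by apply/permP => x; rewrite moveE transpE !perm1. Qed.

Lemma banded_moves_group_set : group_set banded_moves.
Proof.
apply/group_setP; split.
  apply/banded_movesP; exists false, 1, 1; split; rewrite ?group1 //.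
  by apply/permP => x; rewrite moveE !perm1; case: x.
move=> _ _ /banded_movesP[t [p [q [hp hq ->]]]] /banded_movesP[t' [p' [q' [hp' hq' ->]]]].
rewrite moveM; apply/banded_movesP; exists (t (+) t').
exists (if t' then q * p' else p * p'), (if t' then p * q' else q * q').
by case: t'; rewrite !groupM.
Qed.
Canonical banded_moves_group := Group banded_moves_group_set.

Lemma H9_banded : H9 \subset banded_moves.
Proof.
rewrite gen_subG; apply/subsetP => h /setUP[/setUP[]|/set1P->].
- case/imsetP=> p /(subsetP line_gens_banded) hp ->.
  by apply/banded_movesP; exists false, p, 1; rewrite group1 hp rowp_move.
- case/imsetP=> p /(subsetP line_gens_banded) hp ->.
  by apply/banded_movesP; exists false, 1, p; rewrite group1 hp colp_move.
- by apply/banded_movesP; exists true, 1, 1; rewrite group1 transp_move.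
Qed.

Lemma line_gens_H9 p : p \in <<line_gens>> -> rowp p \in H9 /\ colp p \in H9.
Proof.
(* [rowp] and [colp] are morphisms, so the line permutations lifting into [H9] both ways form a
   group; it contains the generators. *)
pose A := [set p : {perm 'I_9} | (rowp p \in H9) && (colp p \in H9)].
have gA : group_set A.
  apply/group_setP; split=> [|q r]; rewrite !inE.
    have -> : rowp 1 = 1 by apply/permP => -[x y]; rewrite rowpE !perm1.
    have -> : colp 1 = 1 by apply/permP => -[x y]; rewrite colpE !perm1.
    by rewrite !group1.
  have -> : rowp (q * r) = rowp q * rowp r by apply/permP => x; rewrite !(rowpE, permM).
  have -> : colp (q * r) = colp q * colp r by apply/permP => x; rewrite !(colpE, permM).
  by case/andP=> ? ? /andP[? ?]; rewrite !groupM.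
suff /subsetP sA : <<line_gens>> \subset Group gA.
  by move=> /sA; rewrite inE => /andP[].
rewrite gen_subG; apply/subsetP => q hq; rewrite inE /=.
by apply/andP; split; apply: mem_gen; rewrite !inE imset_f ?orbT.
Qed.

Lemma transp_H9 : transp \in H9.
Proof. by apply: mem_gen; rewrite !inE eqxx orbT. Qed.

Lemma transp_magic : transp \in magic_moves.
Proof.
apply/magic_movesP => b /modmagicP[[hr hc hb] hm]; apply/modmagicP; split.
  split=> [r c c'|c r r'|[r c] [r' c']] /=; rewrite !ffunE !transpE /=.
  - exact: (hc r).
  - exact: (hr c).
  - by move=> e1 e2 /hb-/(_ e2 e1)[-> ->].
move=> i j; have [m1 m2 m3 m4] := hm j i; split.
- by move=> u; under eq_bigr do rewrite ffunE transpE; apply: m2.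
- by move=> u; under eq_bigr do rewrite ffunE transpE; apply: m1.
- by under eq_bigr do rewrite ffunE transpE.
(* Transposing a block maps its antidiagonal to itself in reverse order. *)
- rewrite (reindex_inj rev_ord_inj).
  by under eq_bigr do rewrite ffunE transpE /= rev_ordK.
Qed.

(** The bands selected by [e] are first reflected: outer lines are exchanged and the middle one
    stays. Then [s] permutes whole bands. *)
Definition line_move (s : {perm 'I_3}) (e : 'I_3 -> bool) : {perm 'I_9} :=
  (\prod_k if e k then inband_perm k (perm (@rev_ord_inj 3)) else 1) * band_perm s.

Lemma line_moveE s e i u :
  line_move s e (ix i u) = ix (s i) (if e i then rev_ord u else u).
Proof.
pose F k := if e k then inband_perm k (perm (@rev_ord_inj 3)) else 1.
(* Generalised to lists without repetition: only the factor of index [i] moves lines of band [i],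
   and it occurs at most once. *)
have step r : uniq r -> forall u,
    (\prod_(k <- r) F k) (ix i u) = ix i (if (i \in r) && e i then rev_ord u else u).
  elim: r => [|k r IH] /=; first by move=> _ v; rewrite big_nil perm1.
  case/andP=> hk /IH{}IH v; rewrite big_cons permM inE /F.
  have [eik|nik] := eqVneq i k.
    move: IH; rewrite eik (negPf hk) /= => IH; case: (e k); last by rewrite perm1 IH.
    by rewrite inband_permE hd_ix eqxx tl_ix permE IH.
  by case: (e k); rewrite ?perm1 ?inband_permE ?hd_ix ?(negPf nik) IH.
by rewrite permM step ?index_enum_uniq // mem_index_enum band_permE hd_ix tl_ix.
Qed.

Lemma line_move_gen s e : line_move s e \in <<line_gens>>.
Proof.
rewrite groupM ?group_prod // => [k _|]; last by rewrite mem_gen // inE imset_f.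
by case: (e k); rewrite // mem_gen // inE orbC imset2_f.
Qed.

Lemma line_move_banded s e : line_move s e \in banded.
Proof.
have := line_gens_banded; rewrite -gen_subG => /subsetP; apply; exact: line_move_gen.
Qed.

(** Permuting bands moves whole blocks. Reflecting a band permutes the rows of each of its blocks,
    reverses the columns and exchanges the two diagonals, so the eight lines of a block are
    preserved as a family. *)
Lemma row_line_move_magic s e : rowp (line_move s e) \in magic_moves.
Proof.
apply/magic_movesP => b /modmagicP[[hr hc hb] hm]; apply/modmagicP; split.
  split=> [r c c'|c r r'|[r c] [r' c']] /=; rewrite !ffunE !rowpE /=.
  - by move/hr.
  - by move/hc/perm_inj.
  - by move=> /(bandedP _ (line_move_banded s e)) e1 e2 /hb-/(_ e1 e2)[/perm_inj-> ->].
move=> i j; have [m1 m2 m3 m4] := hm (s i) j; split.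
- by move=> u; under eq_bigr do rewrite ffunE rowpE line_moveE; apply: m1.
- move=> v; under eq_bigr do rewrite ffunE rowpE line_moveE /=.
  case: (e i) => //; rewrite (reindex_inj rev_ord_inj).
  by under eq_bigr do rewrite rev_ordK.
- under eq_bigr do rewrite ffunE rowpE line_moveE /=.
  case: (e i) => //; rewrite (reindex_inj rev_ord_inj).
  by under eq_bigr do rewrite rev_ordK.
- under eq_bigr do rewrite ffunE rowpE line_moveE /=.
  case: (e i) => //; rewrite (reindex_inj rev_ord_inj).
  by under eq_bigr do rewrite rev_ordK.
Qed.

Lemma col_line_move_magic s e : colp (line_move s e) \in magic_moves.
Proof.
have -> : colp (line_move s e) = transp * rowp (line_move s e) * transp.
  by apply/permP => x; rewrite !permM colpE !transpE rowpE.
by rewrite !groupM ?transp_magic ?row_line_move_magic.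
Qed.

Lemma move_Hmm t s e s' e' : move t (line_move s e) (line_move s' e') \in Hmm.
Proof.
have [rH _] := line_gens_H9 (line_move_gen s e).
have [_ cH] := line_gens_H9 (line_move_gen s' e').
rewrite HmmE inE !groupM ?row_line_move_magic ?col_line_move_magic //.
  by case: t; rewrite ?transp_magic.
by case: t; rewrite ?transp_H9.
Qed.

Lemma line_move_inj s e s' e' : line_move s e = line_move s' e' -> s = s' /\ e =1 e'.
Proof.
move=> eq_m; have eq_i i : s i = s' i /\ e i = e' i.
  (* The first line of a band reveals both parameters: its image lies in band [s i], and a
     reflection moves it. *)
  have := line_moveE s e i ord0; rewrite eq_m line_moveE => /ix_inj[-> eq_u].
  by split=> //; move: eq_u; case: (e i); case: (e' i) => // /(congr1 val).
by split=> [|i]; [apply/permP => i|]; have [] := eq_i i.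
Qed.

Lemma move_inj t p q t' p' q' :
  move t p q = move t' p' q' -> [/\ t = t', p = p' & q = q'].
Proof.
move=> eq_m; have eq_x x : move t p q x = move t' p' q' x by rewrite eq_m.
have tt' : t = t'.
  (* Two cells of a common row stay in a common row exactly when there is no transpose. *)
  have := eq_x (ord0, ord0); have := eq_x (ord0, ord_max); rewrite !moveE /=.
  by case: t t' {eq_m eq_x} => [] [] // [e1 e2] [e3 e4];
    [move: e2; rewrite e4 | move: e1; rewrite e3] => /perm_inj/(congr1 val).
subst t'; split=> //; apply/permP => r; have := eq_x (r, r); rewrite !moveE /=;
  by case: t {eq_m eq_x} => -[].
Qed.

Lemma card_Hmm_ge : 4608 <= #|Hmm|.
Proof.
pose line := ({perm 'I_3} * {ffun 'I_3 -> bool})%type.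
pose f (x : bool * line * line) :=
  move x.1.1 (line_move x.1.2.1 x.1.2.2) (line_move x.2.1 x.2.2).
have injf : injective f.
  case=> [[t [s e]] [s' e']] [[t1 [s1 e1]] [s1' e1']] /move_inj[/= ->].
  move=> /line_move_inj[-> /ffunP->] /line_move_inj[-> /ffunP->] //.
have <- : #|f @: setT| = 4608.
  by rewrite card_imset // cardsT !card_prod card_bool card_Sn card_ffun card_bool card_ord.
by apply/subset_leq_card/subsetP => _ /imsetP[x _ ->]; apply: move_Hmm.
Qed.

(** * Backtracking search over tables of values *)

Local Open Scope nat_scope.

(* [rtab f n] is the reversed list f (n - 1), ..., f 0, and [entry] reads such a list
   at the original index. *)
Fixpoint rtab T (f : nat -> T) n := if n is m.+1 then f m :: rtab f m else [::].

Definition entry T (d : T) (s : seq T) a := nth d s ((size s).-1 - a).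

Fixpoint search T (cand : seq T -> seq T) n : seq (seq T) :=
  if n is m.+1 then
    flatten [seq [seq x :: s | x <- cand s] | s <- search cand m]
  else [:: [::]].

Lemma size_rtab T (f : nat -> T) n : size (rtab f n) = n.
Proof. by elim: n => //= n ->. Qed.

Lemma entry_rtab T d (f : nat -> T) n a : a < n -> entry d (rtab f n) a = f a.
Proof.
rewrite /entry size_rtab; elim: n => // n IH /=; rewrite ltnS leq_eqVlt => /predU1P[->|lt_an].
  by rewrite subnn.
by rewrite -(IH lt_an); case: n lt_an {IH} => // n lt_an; rewrite subSn.
Qed.

Lemma notin_rtab (T : eqType) (f : nat -> T) x n :
  (forall a, a < n -> f a != x) -> x \notin rtab f n.
Proof.
elim: n => //= n IH h; rewrite inE negb_or eq_sym h //=.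
by apply: IH => a lt_an; rewrite h // ltnW.
Qed.

(** Completeness of the search, by induction on prefixes; the upper bounds obtained by enumeration
    rest on it. *)
Lemma search_rtab (T : eqType) (f : nat -> T) cand n :
  (forall k, k < n -> f k \in cand (rtab f k)) -> rtab f n \in search cand n.
Proof.
elim: n => //= n IH h; apply/flatten_mapP; exists (rtab f n).
  by apply: IH => k lt_kn; apply/h/ltnW.
by apply: map_f; apply: h.
Qed.

Lemma all_ord n (P : pred nat) : all P (iota 0 n) -> forall i : 'I_n, P i.
Proof. by move=> /allP h i; apply: h; rewrite mem_iota ltn_ord. Qed.

(** Carries the length of a computed list over to a cardinal. Repeated or meaningless codes in [l]
    only weaken the bound. *)
Lemma card_le_decode (T : finType) (C : eqType) (A : {set T}) (l : seq C)
    (dec : C -> T) :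
  (forall x, x \in A -> exists2 c, c \in l & dec c = x) -> #|A| <= size l.
Proof.
move=> h; rewrite -(size_map dec) (leq_trans _ (card_size _)) // subset_leq_card //.
by apply/subsetP => x /h[c lc <-]; apply: map_f.
Qed.

(** * Enumeration of the modular-magic blocks *)

Definition block_lines : seq (nat * nat * nat) :=
  [:: (0, 1, 2); (3, 4, 5); (6, 7, 8); (0, 3, 6); (1, 4, 7); (2, 5, 8);
      (0, 4, 8); (2, 4, 6)].

(** The cells of a block are numbered row by row and the triples in [block_lines] increase, so each
    line is tested at the moment its last cell is filled. *)
Definition block_cand (s : seq nat) : seq nat :=
  [seq x <- iota 0 9 | (x \notin s) &&
     all (fun l => (l.2 == size s) ==>
            (9 %| entry 0 s l.1.1 + entry 0 s l.1.2 + x)) block_lines].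

Definition blocks := Eval vm_compute in search block_cand 9.

Definition blk (b : board) i j a : nat :=
  b (ix i (inord (a %/ 3)), ix j (inord (a %% 3))).

Lemma blkE b i j (u v : 'I_3) : blk b i j (3 * u + v) = b (ix i u, ix j v).
Proof.
have := ltn_ord u; have := ltn_ord v; rewrite /blk => lt_v3 lt_u3.
congr (nat_of_ord (b (ix _ _, ix _ _))); apply: val_inj.
  by rewrite /= inordK; lia.
by rewrite /= inordK; lia.
Qed.

Lemma sum3 (F : 'I_3 -> nat) : \sum_(u < 3) F u = F (inord 0) + F (inord 1) + F (inord 2).
Proof.
rewrite !big_ord_recl big_ord0 addn0 addnA; congr (F _ + F _ + F _);
  by apply: val_inj; rewrite /= inordK.
Qed.

Lemma blk_lines b i j l : magic_block b i j -> l \in block_lines ->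
  9 %| blk b i j l.1.1 + blk b i j l.1.2 + blk b i j l.2.
Proof.
have r0 : rev_ord (inord 0 : 'I_3) = inord 2 by apply: val_inj; rewrite /= !inordK.
have r1 : rev_ord (inord 1 : 'I_3) = inord 1 by apply: val_inj; rewrite /= !inordK.
have r2 : rev_ord (inord 2 : 'I_3) = inord 0 by apply: val_inj; rewrite /= !inordK.
case=> mr mc; rewrite !sum3 r0 r1 r2 => md ma.
have := (mr (inord 0), mr (inord 1), mr (inord 2), (mc (inord 0), mc (inord 1), mc (inord 2))).
rewrite !sum3 => -[[[? ?] ?] [[? ?] ?]].
by rewrite /block_lines !inE; repeat (case/predU1P => [-> //|]); move/eqP->.
Qed.

Lemma blk_inj b i j a c : sud b -> a < 9 -> c < 9 -> blk b i j a = blk b i j c -> a = c.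
Proof.
move=> [_ _ hb] a9 c9 /val_inj/hb; rewrite !hd_ix => /(_ erefl erefl) [].
move=> /ix_inj[_ /(congr1 val) /=]; rewrite !inordK; [|lia..] => e1.
by move=> /ix_inj[_ /(congr1 val) /=]; rewrite !inordK ?ltn_mod // => e2; lia.
Qed.

Lemma blk_blocks b i j : modmagic b -> rtab (blk b i j) 9 \in blocks.
Proof.
case/modmagicP=> sb mb; suff -> : blocks = search block_cand 9.
  apply: search_rtab => k k9; rewrite mem_filter mem_iota leq0n ltn_ord !andbT.
  apply/andP; split.
    apply: notin_rtab => a ak; apply/eqP => e; have : a = k by apply: blk_inj e => //; lia.
    by lia.
  apply/allP => l bl; rewrite size_rtab; apply/implyP => /eqP lk.
  have := blk_lines (mb i j) bl; rewrite lk.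
  have /allP/(_ _ bl)/andP[lt1 lt2] :
    all (fun l => (l.1.1 < l.2) && (l.1.2 < l.2)) block_lines by [].
  by rewrite !entry_rtab // -lk.
by vm_compute.
Qed.

(** * Gluing blocks along the rows of a band and the columns of a pillar, and counting boards *)

Definition row_compat (s t : seq nat) :=
  all (fun a => all (fun c => (a %/ 3 == c %/ 3) ==> (entry 0 s a != entry 0 t c))
    (iota 0 9)) (iota 0 9).
Definition col_compat (s t : seq nat) :=
  all (fun a => all (fun c => (a %% 3 == c %% 3) ==> (entry 0 s a != entry 0 t c))
    (iota 0 9)) (iota 0 9).

(* Blocks are numbered in base 9, so that comparing two numbers takes few steps. *)
Definition bcode i := (i %/ 9, i %% 9).
Definition bcodes := Eval vm_compute in map bcode (iota 0 72).
(** The two outer levels are indexed by the base 9 digits of a block number: 8 leading and 9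
    trailing digits for the 72 blocks. *)
Definition adjacency (r : rel (seq nat)) : seq (seq (seq (nat * nat))) :=
  [seq [seq [seq bcode y | y <- iota 0 72
                & r (nth [::] blocks (9 * a + c)) (nth [::] blocks y)]
        | c <- iota 0 9] | a <- iota 0 8].
Definition row_adj := Eval vm_compute in adjacency row_compat.
Definition col_adj := Eval vm_compute in adjacency col_compat.
Local Opaque blocks row_adj col_adj.

Definition neighbours (t : seq (seq (seq (nat * nat)))) (x : nat * nat) :=
  nth [::] (nth [::] t x.1) x.2.

Fixpoint meets (T : eqType) (ls : seq (seq T)) (l : seq T) : seq T :=
  if ls is m :: ls' then meets ls' [seq x <- l | x \in m] else l.

(** [s] lists the blocks already placed, latest first. Its first [size s %% 3] entries stand to the
    left in the same band, and positions 2 and 5 hold the blocks one and two bands above. The very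
    first block is unconstrained. *)
Definition board_cand (s : seq (nat * nat)) : seq (nat * nat) :=
  if [seq neighbours row_adj x | x <- take (size s %% 3) s] ++
     [seq neighbours col_adj (nth (0, 0) s o) | o <- [:: 2; 5] & o < size s]
  is l :: ls then meets ls l else bcodes.

Lemma count_boards : size (search board_cand 9) == 72 * 448.
Proof. by vm_cast_no_check (erefl true). Qed.

Lemma index_block s : s \in blocks -> index s blocks < 72.
Proof. by move=> bs; rewrite (_ : 72 = size blocks) // index_mem. Qed.

Lemma neighboursP (r : rel (seq nat)) t s s' :
  t = adjacency r -> s \in blocks -> s' \in blocks -> r s s' ->
  bcode (index s' blocks) \in neighbours t (bcode (index s blocks)).
Proof.
move=> -> bs bs' rss'; rewrite /neighbours /adjacency.
have x72 := index_block bs; have x8 : index s blocks %/ 9 < 8 by lia.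
rewrite (nth_map 0) ?size_iota // (nth_map 0) ?size_iota ?ltn_mod // !nth_iota ?ltn_mod //.
apply: map_f; rewrite mem_filter mem_iota index_block //= !add0n.
by rewrite (_ : 9 * _ + _ = index s blocks) ?nth_index ?rss' //; lia.
Qed.

Lemma row_adjE : row_adj = adjacency row_compat.
Proof. by vm_compute. Qed.

Lemma col_adjE : col_adj = adjacency col_compat.
Proof. by vm_compute. Qed.

Definition block_code (b : board) i j := bcode (index (rtab (blk b i j) 9) blocks).

Definition board_code (b : board) : seq (nat * nat) :=
  rtab (fun k => block_code b (inord (k %/ 3)) (inord (k %% 3))) 9.

Lemma row_neighbours b i j j' : modmagic b -> j != j' ->
  block_code b i j' \in neighbours row_adj (block_code b i j).
Proof.
move=> mb jj'; apply: (neighboursP row_adjE); [exact: blk_blocks | exact: blk_blocks |].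
have /modmagicP[[hr _ _] _] := mb.
apply/allP => a; rewrite mem_iota => a9; apply/allP => c; rewrite mem_iota => c9.
rewrite !entry_rtab //; apply/implyP => /eqP ac; apply: contra jj' => /eqP/val_inj.
by rewrite ac => /hr/ix_inj[->].
Qed.

Lemma col_neighbours b i i' j : modmagic b -> i != i' ->
  block_code b i' j \in neighbours col_adj (block_code b i j).
Proof.
move=> mb ii'; apply: (neighboursP col_adjE); [exact: blk_blocks | exact: blk_blocks |].
have /modmagicP[[_ hc _] _] := mb.
apply/allP => a; rewrite mem_iota => a9; apply/allP => c; rewrite mem_iota => c9.
rewrite !entry_rtab //; apply/implyP => /eqP ac; apply: contra ii' => /eqP/val_inj.
by rewrite ac => /hc/ix_inj[->].
Qed.

(** For an abstract [f] each of the nine positions unfolds by computation, and every filter is an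
    instance of one of the adjacency hypotheses. *)
Lemma board_candP f k : k < 9 -> f k \in bcodes ->
  (forall m n, m < 9 -> n < 9 -> m %/ 3 = n %/ 3 -> m %% 3 != n %% 3 ->
     f n \in neighbours row_adj (f m)) ->
  (forall m n, m < 9 -> n < 9 -> m %/ 3 != n %/ 3 -> m %% 3 = n %% 3 ->
     f n \in neighbours col_adj (f m)) ->
  f k \in board_cand (rtab f k).
Proof.
rewrite /board_cand => k9 fk frow fcol; move: k9 fk.
by do 9 (case: k => [_|k]; first by rewrite //= ?mem_filter ?frow ?fcol).
Qed.

Lemma board_code_search b : modmagic b -> board_code b \in search board_cand 9.
Proof.
move=> mb; apply: search_rtab => k k9.
have ne m n : m < 3 -> n < 3 -> m != n -> inord m != inord n :> 'I_3.
  by move=> m3 n3; rewrite -val_eqE /= !inordK.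
apply: board_candP => // [|m n m9 n9 -> mn|m n m9 n9 mn ->].
- apply: (@map_f _ _ bcode (iota 0 72)).
  by rewrite mem_iota index_block // blk_blocks.
- by rewrite row_neighbours // ne // ltn_mod.
- by rewrite col_neighbours // ne // ltn_divLR.
Qed.

Definition decode_board (l : seq (nat * nat)) : board :=
  [ffun x : cell =>
     let c := entry (0, 0) l (3 * hd x.1 + hd x.2) in
     inord (entry 0 (nth [::] blocks (9 * c.1 + c.2)) (3 * tl x.1 + tl x.2))].

Lemma board_codeK b : modmagic b -> decode_board (board_code b) = b.
Proof.
move=> mb; apply/ffunP => -[r c]; rewrite ffunE /=.
have lt3 (i u : 'I_3) : 3 * i + u < 9 by have := ltn_ord i; have := ltn_ord u; lia.
have key i j :
    nth [::] blocks (9 * (block_code b i j).1 + (block_code b i j).2) = rtab (blk b i j) 9.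
  have := blk_blocks i j mb; rewrite /block_code; move: (rtab _ _) => s bs.
  by rewrite [9 * _]mulnC -divn_eq nth_index.
rewrite !entry_rtab // key.
have -> : inord ((3 * hd r + hd c) %/ 3) = hd r.
  by apply: val_inj; rewrite /= inordK; have := ltn_ord (hd c); have := ltn_ord (hd r); lia.
have -> : inord ((3 * hd r + hd c) %% 3) = hd c.
  by apply: val_inj; rewrite /= inordK ?ltn_mod //; have := ltn_ord (hd c); lia.
by rewrite entry_rtab // blkE !ixK; apply: val_inj; rewrite /= inordK.
Qed.

Lemma card_modmagic_le : #|[set b | modmagic b]| <= 72 * 448.
Proof.
rewrite -(eqP count_boards); apply: (@card_le_decode _ _ _ _ decode_board) => b.
by rewrite inE => mb; exists (board_code b); rewrite ?board_code_search ?board_codeK.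
Qed.

(** The four lines through the centre [c] add up to 36 + 3c, so 9 divides 3c; here the fact is read
    off the list of blocks, where index 4 is the centre. *)
Lemma center_dvd3 b i j : modmagic b -> 3 %| b (ix i (inord 1), ix j (inord 1)).
Proof.
move=> mb; have := blk_blocks i j mb => bl.
have /allP/(_ _ bl) : all (fun s => 3 %| entry 0 s 4) blocks by vm_compute.
by rewrite entry_rtab.
Qed.

(** * Relabelings that preserve modular-magic boards *)

Definition sum_preserving : {set {perm 'I_9}} :=
  [set s : {perm 'I_9} | [forall x : 'I_9, forall y : 'I_9, forall z : 'I_9,
     uniq [:: x; y; z] && (9 %| x + y + z) ==> (9 %| s x + s y + s z)]].

Lemma sum_preservingP (s : {perm 'I_9}) :
  reflect (forall x y z : 'I_9, uniq [:: x; y; z] -> 9 %| x + y + z -> 9 %| s x + s y + s z)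
          (s \in sum_preserving).
Proof.
rewrite inE; apply: (iffP forallP) => h x => [y z u d|].
  by have /forallP/(_ y)/forallP/(_ z)/implyP := h x; apply; rewrite u.
apply/forallP => y; apply/forallP => z; apply/implyP => /andP[]; exact: h.
Qed.

Lemma sum_preserving_group_set : group_set sum_preserving.
Proof.
apply/group_setP; split=> [|s t /sum_preservingP hs /sum_preservingP ht];
  apply/sum_preservingP => x y z u d; rewrite ?perm1 // !permM.
by apply: ht; rewrite ?hs // (map_inj_uniq perm_inj [:: x; y; z]).
Qed.
Canonical sum_preserving_group := Group sum_preserving_group_set.

Definition relabel (s : {perm 'I_9}) (b : board) : board := [ffun x => s (b x)].

(** The three cells of a line of a block carry distinct entries, so triples of distinct symbols are
    enough. Repetitions have to be excluded: [rho] turns 1 + 1 + 7 into 2 + 2 + 8. *)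
Lemma relabel_modmagic s b : s \in sum_preserving -> modmagic b -> modmagic (relabel s b).
Proof.
move=> /sum_preservingP hs /modmagicP[[hr hc hb] hm]; apply/modmagicP; split.
  split=> [r c c'|c r r'|x y e1 e2] /=; rewrite !ffunE => /perm_inj.
  - exact: hr.
  - exact: hc.
  - exact: hb.
move=> i j.
have key (u v w u' v' w' : 'I_3) :
    [|| uniq [:: u; v; w] | uniq [:: u'; v'; w']] ->
    9 %| b (ix i u, ix j u') + b (ix i v, ix j v') + b (ix i w, ix j w') ->
    9 %| relabel s b (ix i u, ix j u') + relabel s b (ix i v, ix j v')
         + relabel s b (ix i w, ix j w').
  move=> d; rewrite !ffunE; apply: hs.
  have ne x x' y y' : (x != y) || (x' != y') -> b (ix i x, ix j x') != b (ix i y, ix j y').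
    apply: contraTN => /eqP/hb; rewrite !hd_ix => /(_ erefl erefl)[].
    by move=> /ix_inj[_ ->] /ix_inj[_ ->]; rewrite !eqxx.
  move: d; rewrite /= !inE !andbT !negb_or.
  by case/orP=> /andP[/andP[? ?] ?]; rewrite !ne //; apply/orP; (left + right).
have ne m n : m < 3 -> n < 3 -> m != n -> inord m != inord n :> 'I_3.
  by move=> m3 n3; rewrite -val_eqE /= !inordK.
have d : uniq [:: inord 0; inord 1; inord 2 : 'I_3].
  by rewrite /= !inE !negb_or !ne.
have [m1 m2 m3 m4] := hm i j; split; rewrite ?sum3.
- by move=> u; have := m1 u; rewrite !sum3; apply: key; rewrite d orbT.
- by move=> u; have := m2 u; rewrite !sum3; apply: key; rewrite d.
- by move: m3; rewrite sum3; apply: key; rewrite d.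
- by move: m4; rewrite sum3; apply: key; rewrite d.
Qed.

Lemma actGE g b : actG g b = relabel g.2 (pull (g.1^-1)%g b).
Proof. by apply/ffunP => x; rewrite !ffunE. Qed.

Definition sum_preserving_fun (f : nat -> nat) :=
  all (fun x => all (fun y => all (fun z =>
    uniq [:: x; y; z] && (9 %| x + y + z) ==> (9 %| f x + f y + f z))
    (iota 0 9)) (iota 0 9)) (iota 0 9).

Lemma sum_preserving_val (s : {perm 'I_9}) (f : nat -> nat) :
  (forall x : 'I_9, s x = f x :> nat) -> sum_preserving_fun f -> s \in sum_preserving.
Proof.
move=> sf hf; apply/sum_preservingP => x y z u d; rewrite !sf.
have /all_ord/(_ y)/all_ord/(_ z)/implyP := all_ord hf x; apply.
by rewrite d andbT (map_inj_uniq val_inj [:: x; y; z]).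
Qed.

Definition rho_val (x : nat) := nth 0 [:: 0; 2; 1; 3; 5; 4; 6; 8; 7] x.

Lemma val_rho (x : 'I_9) : rho x = rho_val x :> nat.
Proof.
have e (y : 'I_9) : rho_fun y = rho_val y :> nat.
  by case: y => [[|[|[|[|[|[|[|[|[|]]]]]]]]] //= ?]; rewrite ?inordK.
rewrite mkpermE // => y z /(congr1 val) /=; rewrite !e => eyz; apply/val_inj/eqP.
have : all (fun y => all (fun z => (rho_val y == rho_val z) ==> (y == z))
    (iota 0 9)) (iota 0 9).
  by vm_compute.
by move=> /all_ord/(_ y)/all_ord/(_ z)/implyP; apply; apply/eqP.
Qed.

Definition mu_val k l x := (k * x + l) %% 9.

(** Coprimality makes the affine map injective, so [mkperm] returns it and not its default value,
    the identity. *)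
Lemma val_mu k l (x : 'I_9) : coprime k 9 -> mu k l x = mu_val k l x :> nat.
Proof.
move=> k9; rewrite mkpermE ?inordK ?ltn_mod // => y z /(congr1 val) /=.
rewrite !inordK ?ltn_mod // => /eqP; rewrite eqn_modDr => e; apply: val_inj => /=.
wlog le_yz : y z e / y <= z.
  by move=> hw; case/orP: (leq_total y z) => le; [|symmetry]; apply: hw; rewrite // eq_sym.
move: e; rewrite eq_sym eqn_mod_dvd ?leq_mul // -mulnBr Gauss_dvdr 1?coprime_sym //.
by have := ltn_ord z; case: (posnP (z - y)) => [|p ? /(dvdn_leq p)]; lia.
Qed.

Lemma rho_sum : rho \in sum_preserving.
Proof. by apply: (sum_preserving_val val_rho); vm_compute. Qed.

Lemma mu_sum k l : k \in [:: 1; 2; 4; 5; 7; 8] -> l \in [:: 0; 3; 6] ->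
  mu k l \in sum_preserving.
Proof.
move=> hk hl.
have /allP/(_ _ hk) k9 : all (coprime^~ 9) [:: 1; 2; 4; 5; 7; 8] by [].
apply: (sum_preserving_val (fun x => val_mu l x k9)).
have : all (fun k => all (fun l => sum_preserving_fun (mu_val k l)) [:: 0; 3; 6])
  [:: 1; 2; 4; 5; 7; 8] by vm_compute.
by move=> /allP/(_ _ hk)/allP/(_ _ hl).
Qed.

Lemma Smm_sum : Smm \subset sum_preserving.
Proof.
rewrite gen_subG subUset sub1set rho_sum /=; apply/subsetP => _ /imset2P[k l hk hl ->].
by apply: mu_sum; [move: hk | move: hl]; rewrite inE.
Qed.

(** * Tables of the possible line permutations and relabelings *)

Definition tab (p : {perm 'I_9}) := rtab (fun k => nat_of_ord (p (inord k))) 9.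
Definition of_tab (l : seq nat) : {perm 'I_9} := mkperm (fun x : 'I_9 => inord (entry 0 l x)).

Lemma entry_tab p (x : 'I_9) : entry 0 (tab p) x = p x.
Proof. by rewrite entry_rtab // inord_val. Qed.

Lemma tabK : cancel tab of_tab.
Proof.
move=> p; have e (x : 'I_9) : inord (entry 0 (tab p) x) = p x by rewrite entry_tab inord_val.
by apply/permP => x; rewrite mkpermE ?e // => y z; rewrite !e => /perm_inj.
Qed.

Lemma notin_tab (p : {perm 'I_9}) k : k < 9 ->
  nat_of_ord (p (inord k)) \notin rtab (fun k => nat_of_ord (p (inord k))) k.
Proof.
move=> k9; apply: notin_rtab => a ak; apply/eqP => /val_inj/perm_inj/(congr1 val) /=.
by rewrite !inordK //; lia.
Qed.

(** [head 0 s] is the image of the preceding line: a line that does not open a band follows its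
    predecessor into the same band. Middle lines must go to middle lines. *)
Definition line_cand (s : seq nat) : seq nat :=
  [seq x <- iota 0 9 | [&& x \notin s,
     (size s %% 3 == 0) || (x %/ 3 == head 0 s %/ 3) &
     (size s %% 3 == 1) ==> (x %% 3 == 1)]].

Definition line_tabs := Eval vm_compute in search line_cand 9.

Lemma line_tabsE : line_tabs = search line_cand 9.
Proof. by vm_compute. Qed.

Lemma tab_line p : p \in banded -> (forall i, tl (p (ix i (inord 1))) = inord 1) ->
  tab p \in line_tabs.
Proof.
move=> /bandedP bp cp; rewrite line_tabsE.
apply: search_rtab => k k9; rewrite mem_filter mem_iota leq0n ltn_ord !andbT notin_tab //=.
rewrite size_rtab; apply/andP; split.
  case: k k9 => // k k9; case: eqP => //= k3.
  rewrite -eq_hd; apply/eqP/bp/eqP; rewrite eq_hd !inordK ?(ltnW k9) //; lia.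
apply/implyP => /eqP k3; rewrite -val_tl.
suff -> : inord k = ix (hd (inord k)) (inord 1) by rewrite cp inordK.
rewrite -{1}[inord k]ixK; congr (ix _ _); apply: val_inj.
by rewrite /= val_tl !inordK.
Qed.

(** The symbol being assigned is [size s]. Nested conditionals keep call-by-value evaluation from
    computing both tests. *)
Definition sym_cand (s : seq nat) : seq nat :=
  [seq x <- iota 0 9 | (x \notin s) &&
     all (fun a => all (fun c =>
       if a == c then true else
       if 9 %| a + c + size s then 9 %| entry 0 s a + entry 0 s c + x else true)
     (iota 0 (size s))) (iota 0 (size s))].

Definition sym_tabs := Eval vm_compute in search sym_cand 9.

Lemma sym_tabsE : sym_tabs = search sym_cand 9.
Proof. by vm_compute. Qed.

Lemma tab_sym s : s \in sum_preserving -> tab s \in sym_tabs.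
Proof.
move=> /sum_preservingP hs; rewrite sym_tabsE.
apply: search_rtab => k k9; rewrite mem_filter mem_iota leq0n ltn_ord !andbT notin_tab //=.
rewrite size_rtab; apply/allP => a; rewrite mem_iota /= add0n => ak.
apply/allP => c; rewrite mem_iota /= add0n => ck.
case: eqP => // ac; case: ifP => // d; rewrite !entry_rtab //.
apply: hs; rewrite ?inordK ?(ltn_trans ak) ?(ltn_trans ck) //.
by rewrite /= !inE !negb_or -!val_eqE /= !inordK ?(ltn_trans ak) ?(ltn_trans ck) //; lia.
Qed.

(** Both [rho] and [mu 4 0] fix 0, 3 and 6, which shortens the list of relabelings to be tried for
    K. *)
Definition fix036 (s : seq nat) := [&& entry 0 s 0 == 0, entry 0 s 3 == 3 & entry 0 s 6 == 6].
Definition sym_tabs036 := [seq s <- sym_tabs | fix036 s].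

(** * The two representative boards *)

Definition grid := seq (seq nat).
Definition grid_at (B : grid) r c := nth 0 (nth [::] B r) c.
Definition board_of (B : grid) : board := [ffun x : cell => inord (grid_at B x.1 x.2)].

Definition grid1 : grid :=
  [:: [:: 0; 1; 8; 2; 4; 3; 5; 7; 6];
      [:: 2; 3; 4; 7; 6; 5; 1; 0; 8];
      [:: 7; 5; 6; 0; 8; 1; 3; 2; 4];
      [:: 1; 8; 0; 3; 2; 4; 6; 5; 7];
      [:: 5; 6; 7; 1; 0; 8; 4; 3; 2];
      [:: 3; 4; 2; 5; 7; 6; 8; 1; 0];
      [:: 6; 2; 1; 4; 5; 0; 7; 8; 3];
      [:: 4; 0; 5; 8; 3; 7; 2; 6; 1];
      [:: 8; 7; 3; 6; 1; 2; 0; 4; 5]].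

(** Agrees with [grid1] on the first two bands. *)
Definition grid2 : grid :=
  [:: [:: 0; 1; 8; 2; 4; 3; 5; 7; 6];
      [:: 2; 3; 4; 7; 6; 5; 1; 0; 8];
      [:: 7; 5; 6; 0; 8; 1; 3; 2; 4];
      [:: 1; 8; 0; 3; 2; 4; 6; 5; 7];
      [:: 5; 6; 7; 1; 0; 8; 4; 3; 2];
      [:: 3; 4; 2; 5; 7; 6; 8; 1; 0];
      [:: 4; 2; 3; 6; 5; 7; 0; 8; 1];
      [:: 8; 0; 1; 4; 3; 2; 7; 6; 5];
      [:: 6; 7; 5; 8; 1; 0; 2; 4; 3]].

Definition all9 (P : nat -> nat -> bool) := all (fun r => all (P r) (iota 0 9)) (iota 0 9).
Definition all3 (P : nat -> nat -> bool) := all (fun r => all (P r) (iota 0 3)) (iota 0 3).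

Lemma all9P P : all9 P -> forall r c : 'I_9, P r c.
Proof. by move=> /all_ord h r; apply/all_ord/h. Qed.

Lemma all9I (P : nat -> nat -> bool) : (forall r c : 'I_9, P r c) -> all9 P.
Proof.
move=> h; apply/allP => r; rewrite mem_iota => /andP[_ r9].
apply/allP => c; rewrite mem_iota => /andP[_ c9].
exact: (h (Ordinal r9) (Ordinal c9)).
Qed.

Lemma all3P P : all3 P -> forall r c : 'I_3, P r c.
Proof. by move=> /all_ord h r; apply/all_ord/h. Qed.

Definition grid_ok (B : grid) :=
  let e i j u v := grid_at B (3 * i + u) (3 * j + v) in
  [&& all9 (fun r c => grid_at B r c < 9),
      all9 (fun r r' =>
        (r == r') || all (fun c => grid_at B r c != grid_at B r' c) (iota 0 9)),
      all9 (fun c c' =>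
        (c == c') || all (fun r => grid_at B r c != grid_at B r c') (iota 0 9)),
      all3 (fun i j => all3 (fun u v => all3 (fun u' v' =>
        (u == u') && (v == v') || (e i j u v != e i j u' v')))) &
      all3 (fun i j =>
        [&& all (fun u => 9 %| e i j u 0 + e i j u 1 + e i j u 2) (iota 0 3),
            all (fun v => 9 %| e i j 0 v + e i j 1 v + e i j 2 v) (iota 0 3),
            9 %| e i j 0 0 + e i j 1 1 + e i j 2 2 &
            9 %| e i j 0 2 + e i j 1 1 + e i j 2 0])].

Lemma board_of_modmagic B : grid_ok B ->
  modmagic (board_of B) /\ forall r c, board_of B (r, c) = grid_at B r c :> nat.
Proof.
case/and5P=> /all9P lt9 /all9P hc /all9P hr /all3P hb /all3P hm.
have be r c : board_of B (r, c) = grid_at B r c :> nat by rewrite ffunE inordK ?lt9.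
split=> //; apply/modmagicP; split.
  split=> [r c c'|c r r'|x y e1 e2] /(congr1 val) /=.
  - rewrite !be => e; apply/val_inj/eqP; case/orP: (hr c c') => // /all_ord/(_ r).
    by rewrite e eqxx.
  - rewrite !be => e; apply/val_inj/eqP; case/orP: (hc r r') => // /all_ord/(_ c).
    by rewrite e eqxx.
  case: x y e1 e2 => [r c] [r' c'] /= e1 e2.
  rewrite !be -(ixK r) -(ixK r') -(ixK c) -(ixK c') e1 e2.
  have /all3P/(_ (tl r) (tl c))/all3P/(_ (tl r') (tl c')) := hb (hd r') (hd c').
  by rewrite !val_ix; case/orP => [/andP[/eqP/val_inj-> /eqP/val_inj->] //|/negP n /eqP].
have r0 : rev_ord (inord 0 : 'I_3) = inord 2 by apply: val_inj; rewrite /= !inordK.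
have r1 : rev_ord (inord 1 : 'I_3) = inord 1 by apply: val_inj; rewrite /= !inordK.
have r2 : rev_ord (inord 2 : 'I_3) = inord 0 by apply: val_inj; rewrite /= !inordK.
move=> i j; have /and4P[/all_ord m1 /all_ord m2 m3 m4] := hm i j.
by split=> [u|u||]; rewrite sum3 ?r0 ?r1 ?r2 !be !val_ix !inordK.
Qed.

Lemma grid1_ok : grid_ok grid1. Proof. by vm_compute. Qed.
Lemma grid2_ok : grid_ok grid2. Proof. by vm_compute. Qed.

Definition board1 := board_of grid1.
Definition board2 := board_of grid2.

Definition reflect_line : {perm 'I_9} := line_move 1 (fun _ => true).

Lemma val_reflect_line (r : 'I_9) : reflect_line r = 3 * (r %/ 3) + (2 - r %% 3) :> nat.
Proof.
by rewrite -{1}(ixK r) line_moveE perm1 val_ix /= subSS val_hd val_tl.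
Qed.

(* Entries of [board1] divisible by 3 lie on one diagonal of each block;
   reflecting the rows or the columns switches to the other diagonal, so only
   the centre cell carries multiples of 3 in all three boards. *)
Lemma Hmm_center h i j : h \in Hmm ->
  exists i' j', h (ix i (inord 1), ix j (inord 1)) = (ix i' (inord 1), ix j' (inord 1)).
Proof.
rewrite HmmE => /setIP[_ hm]; set x := (_, _).
have [m1 e1] := board_of_modmagic grid1_ok.
have d3 g : g \in magic_moves -> 3 %| board1 (g (h x)).
  move=> gm; have := center_dvd3 i j (magic_movesP _ (groupM hm gm) _ m1).
  by rewrite ffunE permM.
have := d3 _ (group1 _); have := d3 _ (row_line_move_magic 1 (fun _ => true)).
have := d3 _ (col_line_move_magic 1 (fun _ => true)).
rewrite perm1; case: (h x) => r c; rewrite rowpE colpE /= !e1 !val_reflect_line => d1 d2 d3'.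
have /all9P/(_ r c) : all9 (fun r c =>
    [&& 3 %| grid_at grid1 r (3 * (c %/ 3) + (2 - c %% 3)),
        3 %| grid_at grid1 (3 * (r %/ 3) + (2 - r %% 3)) c & 3 %| grid_at grid1 r c] ==>
    (r %% 3 == 1) && (c %% 3 == 1)) by vm_compute.
rewrite d1 d2 d3' /= => /andP[/eqP r1 /eqP c1].
exists (hd r), (hd c); congr (_, _).
  by rewrite -{1}(ixK r); congr ix; apply: val_inj; rewrite /= val_tl inordK.
by rewrite -{1}(ixK c); congr ix; apply: val_inj; rewrite /= val_tl inordK.
Qed.

(** Since block centres go to block centres, both line permutations send middle lines to middle
    lines, and only the tabulated ones remain. *)
Lemma Hmm_move h : h \in Hmm ->
  exists t p q, [/\ tab p \in line_tabs, tab q \in line_tabs & h = move t p q].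
Proof.
move=> hH; have /(subsetP H9_banded)/banded_movesP[t [p [q [bp bq eh]]]] : h \in H9.
  by move: hH; rewrite HmmE => /setIP[].
have c i : tl (p (ix i (inord 1))) = inord 1 /\ tl (q (ix i (inord 1))) = inord 1.
  (* The centre of the diagonal block (i, i) constrains [p] and [q] at once, with or without a
     transpose. *)
  have [i' [j']] := Hmm_center i i hH.
  by rewrite eh moveE; case: t {eh} => -[-> ->]; rewrite !tl_ix.
exists t, p, q; split=> //; apply: tab_line => // i; by have [] := c i.
Qed.

(** The equation of boards is read at the image of each cell, which avoids tabulating inverse
    permutations. *)
Definition carries (B B' : grid) (c : bool * seq nat * seq nat * seq nat) : bool :=
  let: (t, p, q, s) := c in
  all9 (fun r k => entry 0 s (grid_at B r k) ==
    if t then grid_at B' (entry 0 p k) (entry 0 q r)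
    else grid_at B' (entry 0 p r) (entry 0 q k)).

Definition carriers (B B' : grid) (syms : seq (seq nat)) :=
  filter (carries B B')
    [seq (tpq, s) | tpq <- [seq (tp, q) | tp <- [seq (t, p) | t <- [:: true; false],
                                                              p <- line_tabs],
                                          q <- line_tabs],
                    s <- syms].

Definition of_carrier (c : bool * seq nat * seq nat * seq nat) : {perm cell} * {perm 'I_9} :=
  let: (t, p, q, s) := c in (move t (of_tab p) (of_tab q), of_tab s).

(** Completeness of this search: its length bounds a stabiliser, and an empty result separates two
    orbits. *)
Lemma carriersP B B' syms h s : grid_ok B -> grid_ok B' ->
  h \in Hmm -> tab s \in syms -> actG (h, s) (board_of B) = board_of B' ->
  exists2 c, c \in carriers B B' syms & of_carrier c = (h, s).
Proof.
move=> okB okB' /Hmm_move[t [p [q [lp lq ->]]]] ls e.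
have [_ eB] := board_of_modmagic okB; have [_ eB'] := board_of_modmagic okB'.
exists (t, tab p, tab q, tab s); last by rewrite /of_carrier !tabK.
rewrite mem_filter; apply/andP; split; last first.
  by do 3! apply: allpairs_f => //; case: (t).
apply: all9I => r k; have /ffunP/(_ (move t p q (r, k))) := e.
rewrite ffunE /= permK => /(congr1 val) /=; rewrite -entry_tab eB moveE /= => ->.
by case: (t); rewrite eB' /= -!entry_tab.
Qed.

(* Left to the lazy conversion of the kernel: it cuts the conjunctions in [carries]
   short, which call-by-value evaluation does not. *)
Lemma carriers11 : size (carriers grid1 grid1 sym_tabs036) <= 1.
Proof. by exact_no_check (erefl true). Qed.
Lemma carriers22 : size (carriers grid2 grid2 sym_tabs036) <= 6.
Proof. by exact_no_check (erefl true). Qed.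
Lemma carriers12 : carriers grid1 grid2 sym_tabs = [::].
Proof. by exact_no_check (erefl (Nil (bool * seq nat * seq nat * seq nat))). Qed.

(** * The group K, its orbits and its minimality *)

Local Open Scope group_scope.

Definition symK : {set {perm 'I_9}} := <<[set rho; mu 4 0]>>.

Lemma symK_Smm : symK \subset Smm.
Proof.
rewrite genS //; apply/subsetP => s /set2P[] ->; rewrite in_setU1 ?eqxx //.
apply/orP; right; apply/imset2P.
by exists (inord 4 : 'I_9) (inord 0 : 'I_9); rewrite ?inE /= !inordK.
Qed.

Lemma symK_tab s : s \in symK -> tab s \in sym_tabs036.
Proof.
move=> sK; rewrite mem_filter tab_sym ?andbT; last first.
  exact: (subsetP (subset_trans symK_Smm Smm_sum)).
(* The pointwise stabiliser of {0, 3, 6} is a group, so it suffices that it contains both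
   generators. *)
pose F : {set 'I_9} := [set inord 0; inord 3; inord 6].
have /astabP fixF : s \in 'C(F | 'P).
  apply: (subsetP _ _ sK); rewrite gen_subG; apply/subsetP => t /set2P[] ->;
  by apply/astabP => x; rewrite !inE => /orP[/orP[]|] /eqP->; apply: val_inj;
    rewrite /= apermE ?val_rho ?val_mu // !inordK.
have e k : k < 9 -> inord k \in F -> entry 0 (tab s) k == k.
  move=> k9 kF; have := entry_tab s (inord k); rewrite inordK // => ->.
  by have := fixF _ kF; rewrite /= apermE => ->; rewrite inordK.
by rewrite /fix036 !e // !inE eqxx ?orbT.
Qed.

(** The generators have the coprime orders 2 and 3, so 6 divides the order of the group. *)
Lemma card_symK_ge : 6 <= #|symK|.
Proof.
have in9 (P : pred nat) : all P (iota 0 9) -> forall x : 'I_9, P x := @all_ord 9 P.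
have o2 : #[rho] = 2.
  apply: nt_prime_order => //.
    apply/permP => x; apply/val_inj/eqP; rewrite expgS expg1 permM perm1 /= !val_rho.
    by apply: (in9 (fun x => rho_val (rho_val x) == x)).
  by apply/eqP => /permP/(_ (inord 1))/(congr1 val); rewrite /= val_rho perm1 inordK.
have o3 : #[mu 4 0] = 3.
  apply: nt_prime_order => //.
    apply/permP => x; apply/val_inj/eqP; rewrite !expgS expg0 mulg1 !permM perm1 /= !val_mu //.
    by apply: (in9 (fun x => mu_val 4 0 (mu_val 4 0 (mu_val 4 0 x)) == x)).
  by apply/eqP => /permP/(_ (inord 1))/(congr1 val); rewrite /= val_mu // perm1 inordK.
have sub s : s \in [set rho; mu 4 0] -> #[s] %| #|symK|.
  by move=> hs; rewrite order_dvdG // mem_gen.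
have := sub _ (set22 _ _); have := sub _ (set21 _ _); rewrite o2 o3 => d2 d3.
by rewrite dvdn_leq ?cardG_gt0 // (@Gauss_dvd 2 3) // d2.
Qed.

Lemma actG1 : (fun b => actG 1 b) =1 id.
Proof. by move=> b; apply/ffunP => x; rewrite ffunE /= invg1 !perm1. Qed.

Lemma actGM b : act_morph (fun b g => actG g b) b.
Proof. by move=> g h; apply/ffunP => x; rewrite !ffunE /= invMg !permM. Qed.

Canonical board_action := TotalAction actG1 actGM.

Lemma actG_modmagic g b : g \in Gmm -> modmagic b -> modmagic (actG g b).
Proof.
case: g => h s /setXP[hH sS] mb; rewrite actGE; apply: relabel_modmagic.
  exact: (subsetP Smm_sum).
by apply: (magic_movesP _ _) mb; move: hH; rewrite HmmE groupV => /setIP[].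
Qed.

Definition Kmm : {group {perm cell} * {perm 'I_9}} := [group of setX Hmm symK].

Lemma Kmm_Gmm : Kmm \subset Gmm.
Proof. exact/setXS/symK_Smm. Qed.

Lemma card_Kmm_ge : 6 * 4608 <= #|Kmm|.
Proof. by rewrite cardsX mulnC leq_mul ?card_Hmm_ge ?card_symK_ge. Qed.

(** Orbit-stabiliser: the elements of K fixing the board all occur among the carriers of [B] to
    itself. *)
Lemma card_orbit_Kmm_ge B n : grid_ok B -> size (carriers B B sym_tabs036) <= n ->
  #|Kmm| <= #|orb Kmm (board_of B)| * n.
Proof.
move=> okB le_n; rewrite -[orb _ _]/(orbit board_action Kmm (board_of B)) card_orbit.
rewrite -(Lagrange (subsetIl Kmm 'C[board_of B | board_action])) mulnC leq_mul //.
apply: leq_trans le_n; apply: (@card_le_decode _ _ _ _ of_carrier) => -[h s].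
case/setIP=> /setXP[hH sK] /astab1P e.
by apply: carriersP => //; apply: symK_tab.
Qed.

Lemma orb_board12 : board2 \notin orb Gmm board1.
Proof.
apply/imsetP => -[[h s] /setXP[hH sS] e].
have ts : tab s \in sym_tabs by apply/tab_sym/(subsetP Smm_sum).
have [c] := carriersP grid1_ok grid2_ok hH ts (esym e).
by rewrite carriers12.
Qed.

Lemma card_orb_board1 : #|orb Kmm board1| = #|Kmm|.
Proof.
apply/eqP; rewrite eqn_leq leq_imset_card -[X in _ <= X]muln1.
exact: card_orbit_Kmm_ge grid1_ok carriers11.
Qed.

Lemma orb_Gmm_modmagic b : modmagic b -> orb Gmm b \subset [set b | modmagic b].
Proof. by move=> mb; apply/subsetP => _ /imsetP[g gG ->]; rewrite inE actG_modmagic. Qed.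

Lemma orb_Kmm_sub b : orb Kmm b \subset orb Gmm b.
Proof. exact: imsetS Kmm_Gmm. Qed.

Definition Gmm_group : {group {perm cell} * {perm 'I_9}} :=
  [group of setX Hmm <<rho |: mu_gens>>].

Lemma orb_eq (G : {group {perm cell} * {perm 'I_9}}) b b' :
  b' \in orb G b -> orb G b' = orb G b.
Proof. exact: (fun h => elimT (@orbit_eqP _ _ board_action G b' b) h). Qed.

Lemma mem_orb (G : {group {perm cell} * {perm 'I_9}}) b : b \in orb G b.
Proof. exact: (@orbit_refl _ _ _ board_action G b). Qed.

Lemma orb_GmmE b b' : b' \in orb Gmm b -> orb Gmm b' = orb Gmm b.
Proof. exact: (@orb_eq Gmm_group). Qed.

Lemma modmagic_board1 : modmagic board1.
Proof. by have [] := board_of_modmagic grid1_ok. Qed.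

Lemma modmagic_board2 : modmagic board2.
Proof. by have [] := board_of_modmagic grid2_ok. Qed.

Lemma disjoint_orb12 : [disjoint orb Gmm board1 & orb Gmm board2].
Proof.
rewrite -setI_eq0; apply/eqP/setP => b; rewrite !inE; apply/negP => /andP[b1 b2].
have : board2 \in orb Gmm board2 by apply: (mem_orb Gmm_group).
by rewrite -(orb_GmmE b2) (orb_GmmE b1); apply/negP/orb_board12.
Qed.

Lemma modmagic_orbK : [set b | modmagic b] = orb Kmm board1 :|: orb Kmm board2.
Proof.
apply/esym/eqP; rewrite eqEcard; apply/andP; split.
  rewrite subUset !(subset_trans (orb_Kmm_sub _)) ?orb_Gmm_modmagic //.
  - exact: modmagic_board2.
  - exact: modmagic_board1.
have le1 := card_Kmm_ge; have le2 := card_orbit_Kmm_ge grid2_ok carriers22.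
have dis : orb Kmm board1 :&: orb Kmm board2 = set0.
  apply/eqP; rewrite setI_eq0 (disjointW _ _ disjoint_orb12) //; exact: orb_Kmm_sub.
apply: leq_trans card_modmagic_le _; rewrite cardsU dis cards0 subn0 card_orb_board1.
(* With [n] the order of K and [o] the size of the second orbit: 27648 + 4608 = 72 * 448. *)
have arith n o : 6 * 4608 <= n -> n <= o * 6 -> 72 * 448 <= n + o by lia.
exact: arith le1 le2.
Qed.

(** The two K-orbits cover all modular-magic boards and lie in disjoint [Gmm]-orbits, so boards in a
    common [Gmm]-orbit lie in a common K-orbit. *)
Lemma orb_KmmE b : modmagic b -> orb Kmm b = orb Gmm b.
Proof.
move=> mb; apply/eqP; rewrite eqEsubset orb_Kmm_sub; apply/subsetP => b' bb'.
have mb' : b' \in [set b | modmagic b] by apply: subsetP bb'; apply: orb_Gmm_modmagic.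
have {}mb : b \in [set b | modmagic b] by rewrite inE.
have KE x y : y \in orb Kmm x -> orb Kmm y = orb Kmm x.
  exact: orb_eq.
have sub x y : y \in orb Kmm x -> y \in orb Gmm x := subsetP (orb_Kmm_sub x) y.
have disj c : c \in orb Kmm board1 -> c \in orb Gmm board2 -> False.
  move=> /sub c1 c2; have := disjointFr disjoint_orb12 c1; by rewrite c2.
have disj' c : c \in orb Gmm board1 -> c \in orb Kmm board2 -> False.
  move=> c1 /sub c2; have := disjointFr disjoint_orb12 c1; by rewrite c2.
move: mb mb'; rewrite modmagic_orbK => /setUP[b1|b2] /setUP[b1'|b2'].
- by rewrite (KE _ _ b1).
- by case: (disj' b'); rewrite // -(orb_GmmE (sub _ _ b1)).
- by case: (disj b'); rewrite // -(orb_GmmE (sub _ _ b2)).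
- by rewrite (KE _ _ b2).
Qed.

Lemma card_orbits : #|[set orb Gmm b | b in [set b | modmagic b]]| = 2.
Proof.
suff -> : [set orb Gmm b | b in [set b | modmagic b]] = [set orb Gmm board1; orb Gmm board2].
  rewrite cards2; case: eqVneq => // e; case/negP: orb_board12; rewrite e.
  exact: (mem_orb Gmm_group).
apply/setP => S; apply/imsetP/set2P => [[b] | [] ->].
- rewrite modmagic_orbK => /setUP[] /(subsetP (orb_Kmm_sub _)) /orb_GmmE e ->; rewrite e.
    by left.
  by right.
- by exists board1; rewrite // inE modmagic_board1.
- by exists board2; rewrite // inE modmagic_board2.
Qed.

Theorem theorem2p3 :
  let K := setX Hmm (<<[set rho; mu 4 0]>>)%g in
  [/\ K \subset Gmm,
      (forall b : board, modmagic b -> orb K b = orb Gmm b),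
      #|[set orb Gmm b | b in [set b : board | modmagic b]]| = 2 &
      (forall L : {group {perm cell} * {perm 'I_9}},
          L \subset Gmm ->
          (forall b : board, modmagic b -> orb L b = orb Gmm b) ->
          ~ (#|L| < #|K|)%N)].
Proof.
split; [exact: Kmm_Gmm | exact: orb_KmmE | exact: card_orbits |].
(* The orbit of [board1] under [L] is its K-orbit, of size |K|, and an orbit is never larger than
   the group. *)
move=> L _ eqL; apply/negP; rewrite -leqNgt -[X in X <= _]card_orb_board1.
by rewrite (orb_KmmE modmagic_board1) -(eqL _ modmagic_board1) leq_imset_card.
Qed.
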